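(* $H_4\le 96$, $H_5\le 1091$, and $H_6\le 15373$, where $H_n$ is the smallest positive integer $N$ such that every convex body $K$ in $n$-dimensional Euclidean space $\mathbb{E}^n$ can be covered by at most $N$ translates of its interior $\operatorname{int}(K)$.
   Context: $\mathbb{E}^n$ denotes $n$-dimensional Euclidean space. A convex body in $\mathbb{E}^n$ is a convex compact set with non-empty interior. For sets $A,B\subset\mathbb{E}^n$, $C(A,B)$ denotes the smallest number of translates of $B$ required to cover $A$, and $\operatorname{int}(A)$ denotes the interior of $A$. Thus $H_n$ is the maximum of $C(K,\operatorname{int}(K))$ over all convex bodies $K$ in $\mathbb{E}^n$. (Equivalently, $H_n$ is the least number such that every convex body $K$ in $\mathbb{E}^n$ can be covered by at most $H_n$ smaller positive homothetic copies of $K$.) *)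

(* Defs.v *)
From HB Require Import structures.
From mathcomp Require Import all_boot all_order all_algebra.
From mathcomp Require Import all_classical all_reals all_analysis.
Import Order.TTheory GRing.Theory Num.Theory.
Import numFieldNormedType.Exports.

Set Implicit Arguments.
Unset Strict Implicit.
Unset Printing Implicit Defensive.

Local Open Scope classical_set_scope.
Local Open Scope ring_scope.

(* The sup norm carried by 'rV[R]_n induces the Euclidean topology, and only
   the topology and the vector space structure are used below. *)
Definition convex_body (R : realType) (n : nat) (K : set 'rV[R]_n) : Prop :=
  [/\ convex_set K, compact K & K° !=set0].

Definition translate (R : realType) (n : nat) (B : set 'rV[R]_n)
    (t : 'rV[R]_n) : set 'rV[R]_n :=
  [set t + b | b in B].

(* C(A, B) <= N.  Repetitions in s are harmless. *)
Definition covered_by_at_most (R : realType) (n : nat)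
    (A B : set 'rV[R]_n) (N : nat) : Prop :=
  exists2 s : seq 'rV[R]_n, (size s <= N)%N &
    A `<=` \bigcup_(t in [set` s]) translate B t.

Definition Hadwiger_bound (R : realType) (n N : nat) : Prop :=
  (0 < N)%N /\
  forall K : set 'rV[R]_n, convex_body K -> covered_by_at_most K K° N.

(* N = H_n.  Stated as a relation rather than a total function, so that the
   existence of H_n has to be proved and no default value is involved. *)
Definition is_Hadwiger_number (R : realType) (n N : nat) : Prop :=
  Hadwiger_bound R n N /\
  forall M : nat, Hadwiger_bound R n M -> (N <= M)%N.

(* Main.v *)
Require Import Defs.
From mathcomp Require Import all_boot all_order all_algebra.
From mathcomp Require Import all_classical all_reals all_analysis.
From mathcomp Require Import perm ring lra.
Import Order.TTheory GRing.Theory Num.Theory.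
Import numFieldNormedType.Exports.

Set Implicit Arguments.
Unset Strict Implicit.
Unset Printing Implicit Defensive.

Local Open Scope classical_set_scope.
Local Open Scope ring_scope.

(* Enclose K in a parallelepiped of least volume, regarded as the unit cube.
   Minimality yields, for every i, a chord [a_i, a_i + e_i] of K joining two
   opposite facets.  Hence K contains a translate of every box with side
   lengths l_i of sum 1, and its interior one of every box with sum < 1.  If a
   direction d carries z into the interior of K, then d illuminates every point
   of K on a segment from z to a point of K other than that point.  Projecting
   from an interior point to the boundary of the cube, and from the ends of the
   chords within the facets, one sees that it suffices to cover the
   (n-2)-skeleton of the cube by such boxes, up to the 2n ends of the chords.
   An end at which K is not a sharp cone is illuminated as well, provided a
   small neighbourhood of the skeleton is covered.  Among the parallelepipeds of
   least volume take one that maximizes a strictly convex function: then no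
   chord is sharp at both ends, and n further directions suffice.
   The skeleton is covered by 92, 992 and 15328 boxes for n = 4, 5, 6. *)

(** * Illumination by finitely many directions *)

Lemma convex_comb (R : realType) (n : nat) (K : set 'rV[R]_n) (x y : 'rV[R]_n) (t : R) :
  convex_set K -> K x -> K y -> 0 <= t <= 1 -> K (t *: x + (1 - t) *: y).
Proof.
move=> cK Kx Ky /andP[t0 t1].
by have := cK x y (Itv01 t0 t1); rewrite !inE; exact.
Qed.

Lemma interiorP_rV (R : realType) (n : nat) (x : 'rV[R]_n) (K : set 'rV[R]_n) :
  K° x <-> exists2 e : R, 0 < e & 
    forall v : 'rV[R]_n, (forall i, `|v ord0 i| < e) -> K (x + v).
Proof.
split=> [/nbhs_ballP[e /= e0 be]|[e e0 He]].
  exists e => // v Hv; apply: be; rewrite /ball /= /mx_ball; split=> // i j.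
  by rewrite (ord1 i) /ball /= !mxE opprD addrA subrr sub0r normrN.
apply/nbhs_ballP; exists e => //= y; rewrite /ball /= /mx_ball => -[_ Hy].
rewrite -(subrKC x y); apply: He => i.
by rewrite !mxE distrC; have := Hy ord0 i; rewrite /ball.
Qed.

Lemma interior_comb (R : realType) (n : nat) (K : set 'rV[R]_n) (x y : 'rV[R]_n)
    (t : R) :
  convex_set K -> K° x -> K y -> 0 < t <= 1 -> K° (t *: x + (1 - t) *: y).
Proof.
move=> cK /interiorP_rV[e e0 He] Ky /andP[t0 t1].
apply/interiorP_rV; exists (t * e) => [|v Hv]; first exact: mulr_gt0.
have -> : t *: x + (1 - t) *: y + v = t *: (x + t^-1 *: v) + (1 - t) *: y.
  by rewrite scalerDr scalerA mulfV ?gt_eqF// scale1r addrAC.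
apply: convex_comb => //; last by rewrite ltW.
apply: He => i; rewrite mxE normrM gtr0_norm ?invr_gt0//.
by rewrite mulrC ltr_pdivrMr// mulrC.
Qed.

(* Some direction in s illuminates z, which may lie outside K. *)
Definition lit (R : realType) (n : nat) (K : set 'rV[R]_n) (s : seq 'rV[R]_n)
    (z : 'rV[R]_n) : Prop :=
  exists2 d, d \in s & exists2 t : R, 0 < t & K° (z + t *: d).

(** The homothety of ratio 1 / (1 + r) centred at [k] carries [z] to this point, shortens [d]
    without turning it, and maps the interior of K into itself. *)
Lemma lit_comb (R : realType) (n : nat) (K : set 'rV[R]_n) s (z k : 'rV[R]_n) (r : R) :
  convex_set K -> lit K s z -> K k -> 0 <= r -> lit K s ((1 + r)^-1 *: (z + r *: k)).
Proof.
move=> cK [d ds [t t0 Kzt]] Kk r0; exists d => //.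
have r1 : 0 < 1 + r by lra.
exists ((1 + r)^-1 * t); first by rewrite mulr_gt0// invr_gt0.
have -> : (1 + r)^-1 *: (z + r *: k) + (1 + r)^-1 * t *: d =
          (1 + r)^-1 *: (z + t *: d) + (1 - (1 + r)^-1) *: k.
  have -> : 1 - (1 + r)^-1 = (1 + r)^-1 * r by field; rewrite gt_eqF.
  by rewrite -!scalerA !scalerDr addrAC.
by apply: interior_comb => //; rewrite invr_gt0 r1 invf_le1// lerDl.
Qed.

Lemma lit_interior (R : realType) (n : nat) (K : set 'rV[R]_n) s d x :
  d \in s -> K° x -> lit K s x.
Proof.
move=> ds /interiorP_rV[e e0 He]; exists d => //.
have [c Hc] : exists c : R, forall i, `|d ord0 i| <= c.
  exists (\sum_j `|d ord0 j|) => i; rewrite (bigD1 i)//= lerDl.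
  exact: sumr_ge0.
have c0 : 0 < 2 * (1 + `|c|) by rewrite mulr_gt0// ltr_wpDr.
exists (e / (2 * (1 + `|c|))); first by rewrite divr_gt0.
apply/interiorP_rV; exists (e / 2) => [|v Hv]; first by rewrite divr_gt0.
rewrite -addrA; apply: He => i; rewrite 2!mxE.
apply: le_lt_trans (ler_normD _ _) _; rewrite [ltRHS](_ : _ = e / 2 + e / 2); last by field.
apply: ler_ltD => //; rewrite normrM gtr0_norm ?divr_gt0// -mulrA ler_pM2l//.
rewrite invfM -mulrA ler_piMr// mulrC ler_pdivrMr ?mul1r ?ltr_wpDr//.
by apply: le_trans (Hc i) _; apply: le_trans (ler_norm _) _; rewrite lerDr.
Qed.

(* For x in K, once x + t d is interior so is x + t' d for 0 < t' <= t; by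
   compactness a single t then serves all points of K. *)
Lemma lit_covered (R : realType) (n : nat) (K : set 'rV[R]_n) s :
  convex_set K -> compact K -> (forall x, K x -> lit K s x) ->
  covered_by_at_most K K° (size s).
Proof.
move=> cK coK Hs.
pose P (t : R) (x : 'rV[R]_n) := exists2 d, d \in s & K° (x + t *: d).
have cover : \forall t \near 0^'+, K `<=` P t.
  apply: (proj2 (near_covering_withinP K) (proj1 (compact_near_coveringP K) coK)).
  move=> x /Hs[d ds [t t0 Kt]].
  have nx : \forall x' \near x, K° (x' + t *: d).
    apply/interiorP_rV; have /interiorP_rV[e e0 He] := nbhs_interior Kt.
    exists e; first exact: e0.
    by move=> v Hv; rewrite addrAC; apply: He.
  near=> x' t' => Kx'; exists d; first exact: ds.
  have Kx't : K° (x' + t *: d) by near: x'; exact: nx.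
  have t'0 : 0 < t' by near: t'; exact: nbhs_right_gt.
  have t't : t' <= t by near: t'; exact: nbhs_right_le.
  have -> : x' + t' *: d = (t' / t) *: (x' + t *: d) + (1 - t' / t) *: x'.
    rewrite scalerDr scalerA divfK ?gt_eqF// addrAC -scalerDl.
    by rewrite [t' / t + _]addrC subrK scale1r.
  by apply: interior_comb => //; rewrite divr_gt0//= ler_pdivrMr// mul1r.
have [t Ht] : exists t, K `<=` P t.
  by apply: (@filter_ex _ (0^'+) _ _ cover); exact: at_right_proper_filter.
exists [seq - (t *: d) | d <- s]; first by rewrite size_map.
move=> x /Ht[d ds Kd]; exists (- (t *: d)); first exact: map_f.
by exists (x + t *: d) => //; rewrite addrC addrK.
Unshelve. all: by end_near. Qed.

(** * Circumscribed parallelepipeds *)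

Lemma continuous_sum_real (R : realType) (T : topologicalType) (I : Type) (r : seq I)
    (P : pred I) (F : I -> T -> R) :
  (forall i, P i -> continuous (F i)) ->
  continuous (fun x => \sum_(i <- r | P i) F i x).
Proof. by apply: continuous_big; exact: add_continuous. Qed.

Lemma continuous_prod_real (R : realType) (T : topologicalType) (I : Type) (r : seq I)
    (P : pred I) (F : I -> T -> R) :
  (forall i, P i -> continuous (F i)) ->
  continuous (fun x => \prod_(i <- r | P i) F i x).
Proof. by apply: continuous_big; exact: mul_continuous. Qed.

(** The functional is the inner product with [e - y0], where [y0] is the point of [D] nearest to
    [e]. *)
Lemma compact_convex_separation (R : realType) (n : nat) (D : set 'rV[R]_n)
    (e : 'rV[R]_n) :
  convex_set D -> compact D -> D !=set0 -> ~ D e ->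
  exists (u : 'cV[R]_n) (c : R),
    (forall y, D y -> (y *m u) 0 0 <= c) /\ c < (e *m u) 0 0.
Proof.
move=> cD coD D0 De.
pose f (y : 'rV[R]_n) := \sum_i (e 0 i - y 0 i) * (e 0 i - y 0 i).
have cf : continuous f.
  apply: continuous_sum_real => i _ y.
  have cd : {for y, continuous (fun y : 'rV[R]_n => e 0 i - y 0 i)}.
    by apply: continuousB; [exact: cst_continuous|exact: coord_continuous].
  exact: (cvgM cd cd).
have [y0 y0D Hy0] := compact_EVT_min D0 coD (continuous_subspaceT cf).
rewrite inE in y0D.
have dotE (y : 'rV[R]_n) (w : 'rV[R]_n) : (y *m w^T) 0 0 = \sum_i y 0 i * w 0 i.
  by rewrite mxE; apply: eq_bigr => i _; rewrite mxE.
have fpos : 0 < f y0.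
  rewrite lt_neqAle eq_sym; apply/andP; split; last first.
    by apply: sumr_ge0 => i _; rewrite -expr2 sqr_ge0.
  apply/eqP => f0; apply: De; suff -> : e = y0 by [].
  apply/rowP => i; apply/eqP; rewrite -subr_eq0 -sqrf_eq0 expr2; apply/eqP.
  by apply: (psumr_eq0P _ f0) => // j _; rewrite -expr2 sqr_ge0.
exists (e - y0)^T, ((y0 *m (e - y0)^T) 0 0); split; last first.
  rewrite !dotE -subr_gt0 -sumrB.
  rewrite (_ : \sum_i _ = f y0)//; apply: eq_bigr => i _.
  by rewrite !mxE; ring.
move=> y Dy; rewrite -subr_le0 !dotE -sumrB.
set s := \sum_i _.
pose q := \sum_i (y 0 i - y0 0 i) * (y 0 i - y0 0 i).
have q0 : 0 <= q by apply: sumr_ge0 => i _; rewrite -expr2 sqr_ge0.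
(* first variation of the squared distance along the segment from y0 to y *)
have var t : 0 <= t <= 1 -> 0 <= t * (t * q - 2 * s).
  move=> t01; have := Hy0 (t *: y + (1 - t) *: y0).
  rewrite inE => /(_ (convex_comb cD Dy y0D t01)); rewrite -subr_ge0.
  congr (0 <= _); rewrite /f -sumrB /q /s !mulr_sumr -sumrB mulr_sumr.
  by apply: eq_bigr => i _; rewrite !mxE; ring.
rewrite leNgt; apply/negP => s0.
have qs : 0 < q + s by rewrite ltr_wpDl.
(* At this parameter t q < 2 s, so moving from [y0] towards [y] would come closer to [e]. *)
have t0 : 0 < s / (q + s) by rewrite divr_gt0.
have := var (s / (q + s)); rewrite (ltW t0) ler_pdivrMr// mul1r lerDr.
move=> /(_ q0); rewrite pmulr_rge0//.
rewrite (_ : _ * q - _ = - (s * (q + 2 * s)) / (q + s)); last by field; rewrite gt_eqF.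
rewrite pmulr_lge0 ?invr_gt0// oppr_ge0 leNgt mulr_gt0//.
by rewrite ltr_wpDl// mulr_gt0.
Qed.

Section Position.
Variables (R : realType) (n : nat).
Implicit Types (V : 'M[R]_n) (K : set 'rV[R]_n).

(* The columns of V are n linear functionals; those of width at most 1 on K
   describe the parallelepipeds circumscribed to K, of volume 1 / |det V|. *)
Definition width_le1 K V := forall x y (j : 'I_n), K x -> K y -> ((x - y) *m V) 0 j <= 1.

Definition set_col V (i : 'I_n) (u : 'cV[R]_n) : 'M[R]_n :=
  \matrix_(k, j) if j == i then u k 0 else V k j.

Lemma mul_set_col V i u (x : 'rV[R]_n) j :
  (x *m set_col V i u) 0 j = if j == i then (x *m u) 0 0 else (x *m V) 0 j.
Proof.
case: ifPn => [/eqP ->|ji]; rewrite !mxE; apply: eq_bigr => k _; rewrite mxE ?eqxx//.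
by rewrite (negbTE ji).
Qed.

(** The cofactors along column i do not involve that column; divided by det V they form row i of the
    inverse. This row is the i-th edge vector e_i of the parallelepiped. *)
Lemma det_set_col V i u : V \in unitmx ->
  \det (set_col V i u) = \det V * (row i (invmx V) *m u) 0 0.
Proof.
move=> uV; rewrite (expand_det_col _ i) mxE mulr_sumr; apply: eq_bigr => k _.
rewrite !mxE eqxx /invmx uV !mxE -mulrA mulVKf -?unitfE -?unitmxE// mulrC.
congr (_ * _ * _); congr (\det _); apply/matrixP => a b; rewrite !mxE.
by rewrite eq_sym (negbTE (neq_lift _ _)).
Qed.

Lemma continuous_vec_mx (k j : 'I_n) :
  continuous (fun v : 'rV[R]_(n * n) => vec_mx v k j).
Proof.
move=> v; rewrite [X in continuous_at _ X](_ : _ = fun w : 'rV[R]_(n * n) => w 0 (mxvec_index k j)).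
  exact: coord_continuous.
by apply/funext => w; rewrite mxE.
Qed.

(** Differences of points of K include a small multiple of each basis vector, with either sign,
    which bounds the entries; the constraints are closed. *)
Lemma compact_width_le1 K : K° !=set0 ->
  compact [set v : 'rV[R]_(n * n) | width_le1 K (vec_mx v)].
Proof.
move=> [c /interiorP_rV[e e0 He]].
have e20 : 0 < e / 2 by rewrite divr_gt0.
have bnd (v : 'rV[R]_(n * n)) l : width_le1 K (vec_mx v) -> `|v 0 l| <= (e / 2)^-1.
  move=> wv; case: (mxvec_indexP l) => k j.
  have -> : v 0 (mxvec_index k j) = vec_mx v k j by rewrite mxE.
  have Kc (s : R) : `|s| < e -> K (c + s *: delta_mx 0 k).
    move=> se; apply: He => i; rewrite !mxE eqxx/=.
    by case: eqP; rewrite ?mulr1 ?mulr0 ?normr0.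
  have c0 : K (c + 0 *: delta_mx 0 k) by apply: Kc; rewrite normr0.
  have ee2 : `|e / 2| < e by rewrite gtr0_norm// ltr_pdivrMr// mulr2n mulrDr mulr1 ltrDl.
  have cp := Kc _ ee2.
  have cm : K (c + - (e / 2) *: delta_mx 0 k) by apply: Kc; rewrite normrN.
  rewrite -(ler_pM2l e20) mulfV ?gt_eqF//.
  rewrite -(gtr0_norm e20) -normrM ler_norml lerNl -mulNr.
  apply/andP; split.
    have := wv _ _ j cm c0; rewrite scale0r addr0 addrC addKr.
    by rewrite -scalemxAl mxE -rowE mxE.
  have := wv _ _ j cp c0; rewrite scale0r addr0 addrC addKr.
  by rewrite -scalemxAl mxE -rowE mxE.
pose m := (e / 2)^-1.
apply: (subclosed_compact _ (rV_compact (fun=> @segment_compact R (- m) m))); last first.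
  by move=> v wv i; rewrite /= in_itv/= -ler_norml; exact: bnd.
rewrite (_ : mkset _ = \bigcap_(p in [set p : 'rV[R]_n * 'rV[R]_n * 'I_n | K p.1.1 /\ K p.1.2])
    (fun v => ((p.1.1 - p.1.2) *m vec_mx v) 0 p.2) @^-1` [set t | t <= 1]); last first.
  apply/seteqP; split=> [v wv [[x y] j] /= [Kx Ky]|v wv x y j Kx Ky]; first exact: wv.
  exact: (wv (x, y, j)).
apply: closed_bigI => -[[x y] j] _ /=.
apply: (proj1 (continuous_closedP _)); last exact: closed_le.
move=> v; rewrite [X in continuous_at _ X](_ : _ = fun v => \sum_k (x - y) 0 k * vec_mx v k j).
  apply: continuous_sum_real => k _ {}v.
  exact: cvgM (cvg_cst _) (@continuous_vec_mx k j v).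
by apply/funext => w; rewrite mxE.
Qed.
End Position.

Section ExtremalFrame.
Variables (R : realType) (n : nat).
Implicit Types (V : 'M[R]_n) (K : set 'rV[R]_n).

Lemma width_le1_unit K : compact K ->
  exists2 V, V \in unitmx & width_le1 K V.
Proof.
move=> /compact_bounded[M [_ HM]].
have coordle (x : 'rV[R]_n) j : K x -> `|x 0 j| <= `|M| + 1.
  move=> Kx; apply: le_trans (_ : `|x| <= _); last first.
    by apply: HM => //; rewrite (le_lt_trans (ler_norm M))// ltrDl.
  by rewrite [leRHS]/Num.Def.normr/= mx_normrE; apply/bigmax_geP; right; exists (0, j).
pose b := (`|M| + 1) + (`|M| + 1).
have b0 : 0 < b by rewrite addr_gt0// ltr_wpDl.
exists (b^-1)%:M => [|x y j Kx Ky].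
  by rewrite unitmxE det_scalar unitfE expf_neq0// gt_eqF// invr_gt0.
rewrite mul_mx_scalar !mxE mulrC ler_pdivrMr// mul1r.
by apply: le_trans (ler_norm _) _; apply: le_trans (ler_normB _ _) _; apply: lerD; exact: coordle.
Qed.

(* Among the matrices of largest determinant the one of largest Euclidean norm
   is chosen: shearing it further must violate the width constraint. *)
Lemma extremal_frame K : compact K -> K° !=set0 ->
  exists V, [/\ V \in unitmx, width_le1 K V,
    forall i u, width_le1 K (set_col V i u) -> `|(row i (invmx V) *m u) 0 0| <= 1 &
    forall i u, width_le1 K (set_col V i u) -> `|(row i (invmx V) *m u) 0 0| = 1 ->
      \sum_k u k 0 ^+ 2 <= \sum_k V k i ^+ 2].
Proof.
move=> coK K0; have coC := compact_width_le1 K0; set C := mkset _ in coC.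
have [V0 uV0 wV0] := width_le1_unit coK.
have CE V : width_le1 K V -> C (mxvec V) by rewrite /C /= mxvecK.
have C0 : C !=set0 by exists (mxvec V0); exact: CE.
pose f (v : 'rV[R]_(n * n)) := `|\det (vec_mx v)|.
have cf : continuous f.
  have cdet : continuous (fun v : 'rV[R]_(n * n) => \det (vec_mx v)).
    apply: continuous_sum_real => /= s _ v.
    have cp : continuous (fun v : 'rV[R]_(n * n) => \prod_k vec_mx v k ((s : {perm 'I_n}) k)).
      by apply: continuous_prod_real => k _; exact: continuous_vec_mx.
    exact: cvgM (cvg_cst _) (cp v).
  by move=> v; exact: cvg_norm (cdet v).
have [v1 v1C Hv1] := compact_EVT_max C0 coC (continuous_subspaceT cf).
have coC' : compact (C `&` f @^-1` [set t | f v1 <= t]).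
  apply: compact_closedI => //.
  by apply: (proj1 (continuous_closedP _)) => //; exact: closed_ge.
pose g (v : 'rV[R]_(n * n)) := \sum_k \sum_j vec_mx v k j ^+ 2.
have cg : continuous g.
  apply: continuous_sum_real => k _; apply: continuous_sum_real => j _ v.
  exact: (cvgM (@continuous_vec_mx _ _ k j v) (@continuous_vec_mx _ _ k j v)).
have [|v2 v2C Hv2] := compact_EVT_max _ coC' (continuous_subspaceT cg).
  by exists v1; split; [exact: set_mem|exact: lexx].
have [wv2 /= fv2] := set_mem v2C.
have fpos : 0 < f v1.
  apply: lt_le_trans (Hv1 _ (mem_set (CE _ wV0))); rewrite /f mxvecK normr_gt0.
  by rewrite -unitfE -unitmxE.
pose V := vec_mx v2.
have dV : 0 < `|\det V| by exact: lt_le_trans fv2.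
have uV : V \in unitmx by rewrite unitmxE unitfE -normr_gt0.
have fE V' : f (mxvec V') = `|\det V'| by rewrite /f mxvecK.
exists V; split => // i u wu.
  rewrite -(ler_pM2l dV) mulr1 -normrM -det_set_col// -(fE (set_col V i u)).
  by apply: (le_trans _ fv2); apply/Hv1/mem_set/CE.
move=> u1; have : g (mxvec (set_col V i u)) <= g v2.
  apply/Hv2/mem_set; split; first exact: CE.
  by rewrite /= fE det_set_col// normrM u1 mulr1.
rewrite /g mxvecK -subr_ge0 -sumrB => H.
rewrite -subr_ge0 -sumrB; apply: le_trans H _; rewrite le_eqVlt; apply/orP; left.
apply/eqP/eq_bigr => k _; rewrite (bigD1 i)//= [X in _ - X](bigD1 i)//=.
rewrite [set_col _ _ _ _ i]mxE eqxx.
rewrite opprD addrACA [X in _ + X](_ : _ = 0) ?addr0// -sumrB big1// => j ji.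
by rewrite [set_col _ _ _ _ j]mxE (negbTE ji) subrr.
Qed.

End ExtremalFrame.

(** * Illumination from the skeleton *)

(** Follow the ray from [y] in direction [-v] up to its first exit through a coordinate in [S]. *)
Lemma exit_cube (R : realFieldType) (n : nat) (S : pred 'I_n) (y v : 'I_n -> R) (j : 'I_n) :
  (forall l, S l -> 0 <= y l <= 1) -> S j -> v j != 0 ->
  exists (r : R) (l : 'I_n), [/\ 0 <= r, S l, y l - r * v l = 0 \/ y l - r * v l = 1 &
    forall l', S l' -> 0 <= y l' - r * v l' <= 1].
Proof.
move=> y01 Sj vj.
(* The time at which coordinate l meets the value it heads for: 0 if [v l > 0], 1 if [v l < 0]. *)
pose T l := (y l - ((v l < 0)%R : nat)%:R) / v l.
have T0 l : S l -> v l != 0 -> 0 <= T l.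
  move=> /y01/andP[y0 y1] vl; rewrite /T; case: ltgtP vl => // vl _.
    by rewrite -mulrNN -invrN divr_ge0 ?oppr_ge0 ?subr_le0// ltW.
  by rewrite subr0 divr_ge0// ltW.
have [|l /andP[Sl vl] Tl] := @arg_minP _ _ _ j (fun l => S l && (v l != 0)) T.
  by rewrite Sj.
exists (T l), l; split=> //; first exact: T0.
  rewrite /T divfK// subKr; case: (v l < 0)%R; [by right|by left].
move=> k Sk; have /andP[y0 y1] := y01 _ Sk.
have T1 := T0 _ Sl vl.
have [vk|vk|->] := ltgtP (v k) 0; last by rewrite mulr0 subr0 y0.
  have : T l <= T k by apply: Tl; rewrite Sk lt_eqF.
  rewrite {2}/T vk mulr1n ler_ndivlMr// => H; have : T l * v k <= 0 by rewrite mulr_ge0_le0// ltW.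
  by move=> H'; apply/andP; split; lra.
have : T l <= T k by apply: Tl; rewrite Sk gt_eqF.
rewrite {2}/T (lt_gtF vk) subr0 ler_pdivlMr// => H.
have {}H : T l * v k <= y k by exact: H.
have : 0 <= T l * v k by rewrite mulr_ge0// ltW.
by move=> H'; apply/andP; split; lra.
Qed.

(** Puts boxes of side sum below 1 into the interior: [k i] will run over the i-th chord, and [c]
    keeps a positive weight. *)
Lemma interior_sum (R : realType) (n : nat) (K : set 'rV[R]_n) (c : 'rV[R]_n)
    (I : Type) (r : seq I) (k : I -> 'rV[R]_n) (l : I -> R) :
  convex_set K -> K° c -> (forall i, K (k i)) -> (forall i, 0 <= l i) ->
  \sum_(i <- r) l i < 1 ->
  K° (\sum_(i <- r) l i *: k i + (1 - \sum_(i <- r) l i) *: c).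
Proof.
move=> cK Kc Kk; elim: r l => [|i r IH] l l0.
  by rewrite !big_nil subr0 scale1r add0r.
rewrite !big_cons => lt1.
have s0 : 0 <= \sum_(j <- r) l j by exact: sumr_ge0.
have li1 : 0 < 1 - l i by lra.
have := IH (fun j => l j / (1 - l i)) (fun j => divr_ge0 (l0 j) (ltW li1)).
rewrite -mulr_suml ltr_pdivrMr// mul1r ltrBrDl => /(_ lt1) H.
have := @interior_comb R n K _ (k i) (1 - l i) cK H (Kk i).
rewrite li1/= gerBl => /(_ (l0 i)); congr (interior K _).
rewrite subKr scalerDr scaler_sumr scalerA addrC addrA; congr (_ + _ + _ *: _).
  by apply: eq_bigr => j _; rewrite scalerA mulrC divfK ?gt_eqF.
by field; rewrite gt_eqF.
Qed.

Section Frame.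
Variables (R : realType) (n : nat) (K : set 'rV[R]_n) (V : 'M[R]_n).
Hypotheses (cK : convex_set K) (coK : compact K) (uV : V \in unitmx) (wV : width_le1 K V).

Local Notation phi x j := ((x *m V) 0 j).
Local Notation e i := (row i (invmx V)).

Lemma phiD (x y : 'rV[R]_n) j : phi (x + y) j = phi x j + phi y j.
Proof. by rewrite mulmxDl mxE. Qed.

Lemma phiB (x y : 'rV[R]_n) j : phi (x - y) j = phi x j - phi y j.
Proof. by rewrite mulmxBl !mxE. Qed.

Lemma phiZ t (x : 'rV[R]_n) j : phi (t *: x) j = t * phi x j.
Proof. by rewrite -scalemxAl mxE. Qed.

Lemma phi_frame i j : phi (e i) j = (i == j)%:R.
Proof. by rewrite -row_mul mulVmx// !mxE. Qed.

Lemma phi_sum (x : 'rV[R]_n) : x = \sum_i phi x i *: e i.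
Proof. by rewrite -mulmx_sum_row mulmxK. Qed.

Lemma phi_eq (x y : 'rV[R]_n) : (forall j, phi x j = phi y j) -> x = y.
Proof. by move=> xy; rewrite (phi_sum x) (phi_sum y); apply: eq_bigr => i _; rewrite xy. Qed.

(** Otherwise a functional separates e_i from the difference body K - K; rescaled, it has width at
    most 1 on K but exceeds 1 at e_i. *)
Lemma frame_chord i : K !=set0 ->
  (forall u, width_le1 K (set_col V i u) -> `|(e i *m u) 0 0| <= 1) ->
  exists2 a, K a & K (a + e i).
Proof.
move=> [x0 Kx0] Hi.
pose D := (fun p : 'rV[R]_n * 'rV[R]_n => p.1 - p.2) @` (K `*` K).
have D0 : D 0 by exists (x0, x0) => //=; rewrite subrr.
have [[[x y] /= [Kx Ky] xy]|De] := pselect (D (e i)).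
  by exists y => //; rewrite -xy addrC subrK.
have coD : compact D.
  apply: continuous_compact; last exact: compact_setX.
  by apply: continuous_subspaceT => p; apply: cvgB; [exact: cvg_fst|exact: cvg_snd].
have cD : convex_set D.
  move=> _ _ t /set_mem[[x1 y1] /= [Kx1 Ky1] <-] /set_mem[[x2 y2] /= [Kx2 Ky2] <-].
  apply/mem_set; exists (t%:num *: x1 + (1 - t%:num) *: x2, t%:num *: y1 + (1 - t%:num) *: y2).
    by split; apply: convex_comb => //; rewrite ge0 le1.
  rewrite [RHS](_ : _ = t%:num *: (x1 - y1) + (1 - t%:num) *: (x2 - y2))//.
  by rewrite /= !scalerBr opprD addrACA.
have [u [c [Hc ce]]] := compact_convex_separation cD coD (ex_intro _ _ D0) De.
have c0 : 0 <= c by have := Hc 0 D0; rewrite mul0mx mxE.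
(* [c] may be 0; the midpoint [c'] is positive, so the functional can be divided by it. *)
pose c' := (c + (e i *m u) 0 0) / 2.
have cc' : c < c' by rewrite /c'; lra.
have c'e : c' < (e i *m u) 0 0 by rewrite /c'; lra.
have c'0 : 0 < c' by exact: le_lt_trans cc'.
have uE (x : 'rV[R]_n) : (x *m (c'^-1 *: u)) 0 0 = (x *m u) 0 0 / c'.
  by rewrite -scalemxAr mxE mulrC.
have : `|(e i *m (c'^-1 *: u)) 0 0| <= 1.
  apply: Hi => x y j Kx Ky; rewrite mul_set_col; case: ifP => _; last exact: wV.
  rewrite uE ler_pdivrMr// mul1r; apply: le_trans (ltW cc'); apply: Hc.
  by exists (x, y).
by rewrite leNgt uE (lt_le_trans _ (ler_norm _))// ltr_pdivlMr// mul1r.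
Qed.

(* If K is a cone at both ends of a chord, both shears of the i-th functional
   by the j-th one are admissible, against the choice of V. *)
Lemma frame_not_sharp i j a (eta : R) : i != j -> 0 < eta ->
  (forall u, width_le1 K (set_col V i u) -> `|(e i *m u) 0 0| = 1 ->
     \sum_k u k 0 ^+ 2 <= \sum_k V k i ^+ 2) ->
  (forall k, K k -> eta * `|phi (k - a) j| <= phi (k - a) i) ->
  ~ (forall k, K k -> eta * `|phi (a + e i - k) j| <= phi (a + e i - k) i).
Proof.
move=> ij eta0 Hi Ha Hb.
have shear s : `|s| = eta -> \sum_k (V k i + s * V k j) ^+ 2 <= \sum_k V k i ^+ 2.
  move=> se; pose u := col i V + s *: col j V.
  have uE (x : 'rV[R]_n) : (x *m u) 0 0 = phi x i + s * phi x j.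
    rewrite mulmxDr -scalemxAr !mxE.
    by congr (_ + _ * _); apply: eq_bigr => k _; rewrite mxE.
  have := Hi u; rewrite uE !phi_frame eqxx (negbTE ij) mulr0 addr0 normr1.
  rewrite (eq_bigr (fun k => (V k i + s * V k j) ^+ 2)); last by move=> k _; rewrite !mxE.
  apply => // x y l Kx Ky; rewrite mul_set_col; case: ifP => _; last exact: wV.
  rewrite uE; have := Ha _ Ky; have := Hb _ Kx.
  have bound t : s * t <= eta * `|t| by rewrite -se -normrM ler_norm.
  have := bound (phi (y - a) j); have := bound (phi (a + e i - x) j).
  have := bound (- phi (y - a) j); have := bound (- phi (a + e i - x) j).
  rewrite !normrN !phiB !phiD !phi_frame eqxx (negbTE ij) mulr0n mulr1n !addr0.
  lra.
have Hp := shear eta (gtr0_norm eta0).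
have Hm := shear (- eta) (etrans (normrN _) (gtr0_norm eta0)).
(* The squared norms of the two sheared columns average to that of column i plus that of eta times
   column j, so column j vanishes. *)
have H : \sum_k (eta * V k j) ^+ 2 <= 0.
  have -> : \sum_k (eta * V k j) ^+ 2 =
      (\sum_k (V k i + eta * V k j) ^+ 2 + \sum_k (V k i + - eta * V k j) ^+ 2) / 2
      - \sum_k V k i ^+ 2.
    by rewrite -big_split/= mulr_suml -sumrB; apply: eq_bigr => k _; field.
  lra.
have S0 : \sum_k (eta * V k j) ^+ 2 = 0.
  by apply/eqP; rewrite eq_le H sumr_ge0// => k _; rewrite sqr_ge0.
have Vj0 k : V k j = 0.
  have : (eta * V k j) ^+ 2 = 0 by apply: (psumr_eq0P _ S0) => // l _; exact: sqr_ge0.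
  by move=> /eqP; rewrite sqrf_eq0 mulf_eq0 gt_eqF//= => /eqP.
have := phi_frame j j; rewrite mxE eqxx big1 => [/esym/eqP|k _]; first by rewrite oner_eq0.
by rewrite Vj0 mulr0.
Qed.

End Frame.

Section Cover.
Variables (R : realType) (n : nat) (eta : R) (boxes : seq ('rV[R]_n * 'rV[R]_n)).

Definition near01 (t : R) := t <= eta \/ 1 - eta <= t.

(* (q, l) stands for the box with lowest corner q and side lengths l; the
   condition on x describes the eta-neighbourhood of the (n-2)-skeleton. *)
Definition skeleton_cover :=
  (forall p, p \in boxes -> (forall i, 0 <= p.2 0 i) /\ \sum_i p.2 0 i < 1) /\
  forall x : 'I_n -> R, (forall i, - eta <= x i <= 1 + eta) ->
    (exists i j, [/\ i != j, near01 (x i) & near01 (x j)]) ->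
    exists2 p, p \in boxes & forall i, p.1 0 i <= x i <= p.1 0 i + p.2 0 i.

Variables (K : set 'rV[R]_n) (V : 'M[R]_n) (a : 'I_n -> 'rV[R]_n) (c : 'rV[R]_n).
Hypotheses (cK : convex_set K) (uV : V \in unitmx) (wV : width_le1 K V).
Hypotheses (Kc : K° c) (n1 : (1 < n)%N) (eta01 : 0 < eta < 1) (coverB : skeleton_cover).

Local Notation phi x j := ((x *m V) 0 j).
Local Notation e i := (row i (invmx V)).
Local Notation coor x i := (phi x i - phi (a i) i).

Hypotheses (Ka : forall i, K (a i)) (Kae : forall i, K (a i + e i)).

Lemma coor01 x i : K x -> 0 <= coor x i <= 1.
Proof.
move=> Kx; have := wV i Kx (Ka i); have := wV i (Kae i) Kx.
by rewrite !phiB phiD phi_frame// eqxx mulr1n => H1 H2; apply/andP; split; lra.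
Qed.

(** The translation carrying the box [p], in the coordinates [coor], onto the sum of the chords
    scaled by [p.2 0 i] and a multiple of [c]. *)
Definition box_light (p : 'rV[R]_n * 'rV[R]_n) : 'rV[R]_n :=
  \sum_i p.2 0 i *: a i + (1 - \sum_i p.2 0 i) *: c
  - \sum_i (p.1 0 i + phi (a i) i) *: e i.

Lemma box_light_lit (s : seq 'rV[R]_n) (x : 'rV[R]_n) :
  {subset [seq box_light p | p <- boxes] <= s} ->
  (forall i, - eta <= coor x i <= 1 + eta) ->
  (exists i j, [/\ i != j, near01 (coor x i) & near01 (coor x j)]) -> lit K s x.
Proof.
move=> bs x01 xij; have [p pb Hp] := coverB.2 (fun i => coor x i) x01 xij.
have [p0 p1] := coverB.1 _ pb.
exists (box_light p); first by apply: bs; exact: map_f.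
exists 1 => //; rewrite scale1r.
(* Relative position along side i. A side of length 0 gives the default [t i = 0], which is right
   since then [coor x i = p.1 0 i]. *)
pose t i := (coor x i - p.1 0 i) / p.2 0 i.
pose k i := t i *: (a i + e i) + (1 - t i) *: a i.
have Kk i : K (k i).
  apply: convex_comb => //; have /andP[q0 q1] := Hp i; rewrite /t.
  have [->|l0] := eqVneq (p.2 0 i) 0; first by rewrite invr0 mulr0 lexx ler01.
  have {}l0 : 0 < p.2 0 i by rewrite lt_neqAle eq_sym l0 p0.
  by rewrite divr_ge0 ?subr_ge0 ?p0//= ler_pdivrMr// mul1r lerBlDl.
have := interior_sum (r := index_enum 'I_n) cK Kc Kk p0 p1.
suff -> : x + box_light p = \sum_i p.2 0 i *: k i + (1 - \sum_i p.2 0 i) *: c by [].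
rewrite /box_light addrC -addrA addrAC [- _ + x]addrC; congr (_ + _).
rewrite {1}(phi_sum uV x) -sumrB -big_split; apply: eq_bigr => i _ /=.
have /andP[q0 q1] := Hp i; have tE : p.2 0 i * t i = coor x i - p.1 0 i.
  rewrite /t; have [l0|l0] := eqVneq (p.2 0 i) 0; last by rewrite mulrC divfK.
  by move: q0 q1; rewrite l0 mul0r addr0 => q0 q1; apply/eqP; rewrite eq_sym subr_eq0 eq_le q0 q1.
have -> : k i = a i + t i *: e i.
  by rewrite /k scalerDr addrAC -scalerDl addrC [t i + _]addrC subrK scale1r addrC.
by rewrite scalerDr scalerA tE -scalerBl; congr (_ + _ *: _); ring.
Qed.

(** Moving from [x] away from [k] until another coordinate exits, coordinate j varies by at most 1,
    so coordinate i drifts by at most eta. The ray thus ends near the skeleton, at a lit point, and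
    [x] lies between it and [k]. *)
Lemma facet_lit s x k i j :
  {subset [seq box_light p | p <- boxes] <= s} ->
  (forall l, 0 <= coor x l <= 1) -> coor x i = 0 \/ coor x i = 1 -> K k -> i != j ->
  `|phi (k - x) i| < eta * `|phi (k - x) j| -> lit K s x.
Proof.
move=> bs x01 xi Kk ij vij.
have /andP[eta0 eta1] := eta01.
have vj : phi (k - x) j != 0.
  by rewrite -normr_gt0 -(pmulr_rgt0 _ eta0) (le_lt_trans _ vij).
have ji : j != i by rewrite eq_sym.
have [r [l [r0 /= li xl xr]]] := @exit_cube R n (fun l => l != i) (fun l => coor x l)
    (fun l => phi (k - x) l) j (fun l _ => x01 l) ji vj.
pose z := x - r *: (k - x).
have zE m : coor z m = coor x m - r * phi (k - x) m by rewrite phiB phiZ addrAC.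
have rvi : `|r * phi (k - x) i| <= eta.
  have rvj : r * `|phi (k - x) j| <= 1.
    have /andP[] := xr j ji.
    have /andP[] := x01 j; set v := phi (k - x) j => x0 x1 r1 r2.
    by rewrite -{1}(ger0_norm r0) -normrM ler_norml; apply/andP; split; lra.
  rewrite normrM ger0_norm//; apply: le_trans (_ : r * (eta * `|phi (k - x) j|) <= _).
    by apply: ler_wpM2l => //; exact: ltW.
  by rewrite mulrCA ler_piMr// ltW.
move: rvi; rewrite ler_norml => /andP[rvi1 rvi2].
have zl : lit K s z.
  apply: (box_light_lit bs) => [m|]; last first.
    exists i, l; rewrite eq_sym; split => //; rewrite /near01 zE.
      by case: xi => ->; [left|right]; lra.
    by case: xl => ->; [left|right]; lra.
  rewrite zE; have [->|mi] := eqVneq m i.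
    by apply/andP; split; case: xi => ->; lra.
  by have /andP[] := xr _ mi => *; apply/andP; split; lra.
have -> : x = (1 + r)^-1 *: (z + r *: k).
  rewrite /z scalerBr opprB addrA subrK -{2}[x]scale1r -scalerDl scalerA.
  by rewrite mulVf ?scale1r// gt_eqF// ltr_wpDr.
exact: lit_comb.
Qed.

Hypothesis not_sharp : forall i j, i != j ->
  (forall k, K k -> eta * `|phi (k - a i) j| <= phi (k - a i) i) ->
  ~ (forall k, K k -> eta * `|phi (a i + e i - k) j| <= phi (a i + e i - k) i).

Lemma frame_covered : compact K -> covered_by_at_most K K° (size boxes + n).
Proof.
move=> coK; have [|next nextP] := @choice _ _ (fun i j : 'I_n => i != j).
  move=> i.
  have n0 : (0 < n)%N by exact: ltnW.
  have [i0|i0] := eqVneq (i : nat) 0%N.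
    by exists (Ordinal n1); rewrite -val_eqE /= i0.
  by exists (Ordinal n0); rewrite -val_eqE.
(* Testing the cone condition against one other direction suffices. Since at most one end is sharp,
   [apex i] gets its own direction and [facet_lit] handles the other end. *)
pose sharp i := `[< forall k, K k ->
  eta * `|phi (k - a i) (next i)| <= phi (k - a i) i >].
pose apex i := if sharp i then a i else a i + e i.
pose s := [seq box_light p | p <- boxes] ++ [seq c - apex i | i <- enum 'I_n].
have -> : (size boxes + n)%N = size s by rewrite /s size_cat 2!size_map size_enum_ord.
have bs : {subset [seq box_light p | p <- boxes] <= s}.
  by move=> d; rewrite mem_cat => ->.
have apexs i : c - apex i \in s.
  by rewrite mem_cat; apply/orP; right; apply: map_f; rewrite mem_enum.
have /andP[eta0 eta1] := eta01.
have phiae i : phi (a i + e i) i = phi (a i) i + 1 by rewrite phiD phi_frame// eqxx.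
have apex_lit i : lit K s (apex i).
  by exists (c - apex i) => //; exists 1 => //; rewrite scale1r addrC subrK.
have ends_lit i : lit K s (a i) /\ lit K s (a i + e i).
  have [si|nsi] := boolP (sharp i).
    split; first by have := apex_lit i; rewrite /apex si.
    have /existsNP[k /not_implyP[Kk /negP]] := not_sharp (nextP i) (asboolW si).
    rewrite -ltNge => Hk.
    apply: (@facet_lit _ _ k i (next i)) => //; first by move=> l; exact: coor01 (Kae i).
      by right; rewrite phiae addrAC subrr add0r.
    move: Hk; rewrite !phiB phiae => Hk.
    rewrite distrC ger0_norm; first by rewrite [X in _ < _ * X]distrC.
    by have /andP[_] := coor01 i Kk; rewrite subr_ge0 -lerBlDl.
  split; last by have := apex_lit i; rewrite /apex (negbTE nsi).
  have /asboolPn/existsNP[k /not_implyP[Kk /negP]] := nsi.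
  rewrite -ltNge => Hk.
  apply: (@facet_lit _ _ k i (next i)) => //; first by move=> l; exact: coor01 (Ka i).
    by left; rewrite subrr.
  by rewrite ger0_norm// phiB; have /andP[] := coor01 i Kk.
apply: lit_covered => // x Kx.
have [->|xc] := eqVneq x c.
  by apply: (lit_interior (apexs (Ordinal n1))).
have [j vj] : exists j, phi (c - x) j != 0.
  apply: contrapT => /forallNP H; move/eqP: xc; apply.
  apply: (phi_eq uV) => j; apply/eqP; rewrite eq_sym -subr_eq0 -phiB.
  exact/negPn/negP/H.
have [r [i [r0 _ yi y01]]] := @exit_cube R n predT (fun l => coor x l)
  (fun l => phi (c - x) l) j (fun l _ => coor01 l Kx) isT vj.
(* The ray from [c] through [x] leaves the cube at [y], possibly outside K; lighting [y] lights
   [x]. *)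
pose y := x - r *: (c - x).
have yE m : coor y m = coor x m - r * phi (c - x) m by rewrite -phiZ addrAC -(phiB V x).
have -> : x = (1 + r)^-1 *: (y + r *: c).
  rewrite /y scalerBr opprB addrA subrK -{2}[x]scale1r -scalerDl scalerA.
  by rewrite mulVf ?scale1r// gt_eqF// ltr_wpDr.
apply: lit_comb => //; last exact: interior_subset.
(* [p] is the end of chord i on the facet of [y], so [p - y] is parallel to that facet. *)
have [p Kp [pl pi]] : exists2 p, K p & lit K s p /\ phi (p - y) i = 0.
  have [al bl] := ends_lit i; rewrite -yE in yi.
  case: yi => yi; [exists (a i)|exists (a i + e i)] => //; split => //; rewrite phiB ?phiae; lra.
have [->//|yp] := eqVneq y p.
have [l vl] : exists l, phi (p - y) l != 0.
  apply: contrapT => /forallNP H; move/eqP: yp; apply.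
  apply: (phi_eq uV) => l; apply/eqP; rewrite eq_sym -subr_eq0 -phiB.
  exact/negPn/negP/H.
apply: (@facet_lit s y p i l) => //.
- by move=> m; rewrite yE; exact: y01.
- by rewrite yE.
- by apply: contraNneq vl => <-; rewrite pi.
- by rewrite pi normr0 mulr_gt0// normr_gt0.
Qed.
End Cover.

(** * Covering the skeleton of a cube by boxes *)

(* Coordinates are scaled so that the cube is [0, D]^n, and the neighbourhood of
   the skeleton has radius H.  A bit list F stands for the 2^(n - |F|) faces
   whose free coordinates are the true positions of F.  The boxes attached to
   such a face reach to depth W F j in each fixed direction j; in a free
   direction i they form a grid of g F i pieces of the interval [w, D - w], where
   w is the depth, in direction i, of the boxes of the smaller faces on which
   coordinate i is fixed too. *)
Section Faces.
Local Open Scope nat_scope.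
Variables (n D H : nat) (W g : seq bool -> nat -> nat).

Definition clear_bit (F : seq bool) i := set_nth false F i false.

(** The successor of the truncated quotient makes [g F i] pieces overshoot the interval. In a fixed
    direction the box also covers the margin H outside the cube. *)
Definition side F i :=
  if nth false F i then ((D - 2 * W (clear_bit F i) i) %/ g F i).+1 else W F i + H.

(* Lowest corners, shifted by H to remain natural numbers. *)
Definition corners F i :=
  if nth false F i then [seq H + W (clear_bit F i) i + m * side F i | m <- iota 0 (g F i)]
  else [:: 0; H + (D - W F i)].

Fixpoint bits k : seq (seq bool) :=
  if k is k'.+1 then [seq b :: F | b <- [:: true; false], F <- bits k'] else [:: [::]].

Definition low_faces := [seq F <- bits n | count id F <= n - 2].

(** In order: the boxes fit; [D - W F j] is an exact subtraction; faces of dimension n - 2 reach the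
    whole neighbourhood of the skeleton; grids are non-empty and a point in reach of a face stays in
    reach, in the directions already fixed, on passing to a smaller face. *)
Definition face_ok F :=
  [&& sumn [seq side F i | i <- iota 0 n] < D,
      all (fun j => (nth false F j) || (W F j <= D)) (iota 0 n),
      (count id F == n - 2) ==> all (fun j => (nth false F j) || (H <= W F j)) (iota 0 n) &
      all (fun i => nth false F i ==> (0 < g F i) &&
        all (fun j => (nth false F j) || (W F j <= W (clear_bit F i) j)) (iota 0 n)) (iota 0 n)].

Definition face_count F := foldr muln 1 [seq if nth false F i then g F i else 2 | i <- iota 0 n].

Fixpoint prodseq (T : Type) (cs : seq (seq T)) : seq (seq T) :=
  if cs is c :: cs' then [seq x :: y | x <- c, y <- prodseq cs'] else [:: [::]].

Lemma mem_bits k F : size F = k -> F \in bits k.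
Proof.
elim: k F => [|k IH] [|b F]// [sF]; apply/allpairsP; exists (b, F).
by split => //=; [case: b|exact: IH].
Qed.

Lemma size_prodseq (T : Type) (cs : seq (seq T)) :
  size (prodseq cs) = foldr muln 1 [seq size c | c <- cs].
Proof. by elim: cs => [|c cs IH] //=; rewrite size_allpairs IH. Qed.

Lemma mem_prodseq (T : eqType) (x0 : T) (cs : seq (seq T)) y : size y = size cs ->
  (forall i, i < size cs -> nth x0 y i \in nth [::] cs i) -> y \in prodseq cs.
Proof.
elim: cs y => [|c cs IH] [|x y]// [sy] Hy; apply/allpairsP; exists (x, y).
by split => //=; [exact: (Hy 0)|apply: IH => // i; exact: (Hy i.+1)].
Qed.


Lemma low_facesP F : size F = n -> count id F <= n - 2 -> F \in low_faces.
Proof. by move=> sF cF; rewrite mem_filter cF mem_bits. Qed.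

Hypothesis faces_ok : all face_ok low_faces.

Lemma sumn_side F : sumn [seq side F i | i <- iota 0 n] = \sum_(i < n) side F i.
Proof. by rewrite sumnE big_map -[n in iota 0 n]subn0 big_mkord. Qed.

Lemma face_okP F : size F = n -> count id F <= n - 2 ->
  [/\ \sum_(i < n) side F i < D, forall j, j < n -> ~~ nth false F j -> W F j <= D,
    count id F = n - 2 -> forall j, j < n -> ~~ nth false F j -> H <= W F j &
    forall i, i < n -> nth false F i -> 0 < g F i /\
      forall j, j < n -> ~~ nth false F j -> W F j <= W (clear_bit F i) j].
Proof.
move=> sF cF; have /and4P[] := allP faces_ok _ (low_facesP sF cF).
rewrite sumn_side => H1 H2 H3 H4; split => //.
- by move=> j jn /negbTE Fj; have := allP H2 j; rewrite mem_iota Fj => /(_ jn).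
- by move=> /eqP cE j jn /negbTE Fj; have := allP (implyP H3 cE) j; rewrite mem_iota Fj => /(_ jn).
move=> i i_n Fi; have := allP H4 i; rewrite mem_iota i_n Fi => /(_ isT)/andP[g0 /allP H5].
by split => // j jn /negbTE Fj; have := H5 j; rewrite mem_iota Fj => /(_ jn).
Qed.

Variables (R : archiRealFieldType) (X : nat -> R).
Local Open Scope ring_scope.

Definition near_bd F j := (X j <= (W F j)%:R) || (D%:R - (W F j)%:R <= X j).

Definition away_bd F i :=
  (W (clear_bit F i) i)%:R <= X i <= D%:R - (W (clear_bit F i) i)%:R.

Lemma nth_clear_bit F i j : nth false (clear_bit F i) j = nth false F j && (j != i).
Proof. by rewrite nth_set_nth /=; case: eqP; rewrite ?andbF ?andbT. Qed.

(* If x is within reach of a smaller face in a free direction i, continue with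
   that face; this ends at a face whose grid contains x. *)
Lemma descend F : size F = n -> (count id F <= n - 2)%N ->
  (forall j, (j < n)%N -> ~~ nth false F j -> near_bd F j) ->
  exists F', [/\ size F' = n, (count id F' <= n - 2)%N,
    forall j, (j < n)%N -> ~~ nth false F' j -> near_bd F' j &
    forall i, (i < n)%N -> nth false F' i -> away_bd F' i].
Proof.
have [m] := ubnP (count id F); elim: m F => // m IH F cm sF cF Fnear.
have [/allP Faway|/allPn[i]] := boolP (all (fun i => nth false F i ==> away_bd F i) (iota 0 n)).
  exists F; split => // i i_n; apply: implyP; apply: Faway; by rewrite mem_iota.
rewrite mem_iota negb_imply => /andP[_ i_n] /andP[Fi Fia].
have cC : (count id (clear_bit F i) < count id F)%N.
  rewrite /clear_bit.
  rewrite count_set_nth_ltn ?sF// Fi addn0 subn1 ltn_predL -has_count.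
  by apply/(has_nthP false); exists i; rewrite ?sF.
apply: (IH (clear_bit F i)).
- exact: leq_trans cC _.
- by rewrite size_set_nth sF; apply/maxn_idPr.
- exact: leq_trans (ltnW cC) _.
move=> j jn; rewrite nth_clear_bit negb_and negbK.
have [_ _ _ /(_ _ i_n Fi)[_ mono]] := face_okP sF cF.
have [-> _|ji] := eqVneq j i.
  by move: Fia; rewrite /away_bd negb_and -!ltNge /near_bd => /orP[/ltW ->//|/ltW ->]; rewrite orbT.
rewrite orbF => Fj; have /orP[XW|XW] := Fnear j jn Fj; apply/orP; [left|right].
  by apply: le_trans XW _; rewrite ler_nat mono.
by apply: le_trans _ XW; rewrite lerD2l lerN2 ler_nat mono.
Qed.

Lemma corner_cover F i : size F = n -> (count id F <= n - 2)%N -> (i < n)%N ->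
  (~~ nth false F i -> near_bd F i) -> (nth false F i -> away_bd F i) ->
  - H%:R <= X i <= D%:R + H%:R ->
  exists2 q, q \in corners F i &
    q%:R - H%:R <= X i <= q%:R - H%:R + (side F i)%:R.
Proof.
move=> sF cF i_n Fnear Faway /andP[X0 X1].
have [_ WD _ gp] := face_okP sF cF.
rewrite /corners /side; case: ifPn => [Fi|Fi]; last first.
  have /orP[XW|XW] := Fnear Fi.
    by exists 0%N; rewrite ?inE// natrD; apply/andP; split; lra.
  exists (H + (D - W F i))%N; first by rewrite !inE eqxx orbT.
  by rewrite !natrD natrB ?WD//; apply/andP; split; lra.
set w := W (clear_bit F i) i; set s := (_ %/ _).+1.
have /andP[Xw Xw'] := Faway Fi; rewrite -/w in Xw Xw'.
have [g0 _] := gp i i_n Fi.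
have s0 : 0 < s%:R :> R by rewrite ltr0n.
pose m := Num.truncn ((X i - w%:R) / s%:R).
have /truncn_itv/andP[m0 m1] : 0 <= (X i - w%:R) / s%:R by rewrite divr_ge0 ?subr_ge0// ltW.
rewrite -/m ler_pdivlMr// in m0; rewrite -/m ltr_pdivrMr// in m1.
have mg : (m < g F i)%N.
  have ceil : (D - 2 * w < g F i * s)%N by rewrite [(g F i * s)%N]mulnC /s ltn_ceil.
  have DR : D%:R - 2 * w%:R <= (D - 2 * w)%:R :> R.
    by rewrite lerBlDr -natrM -natrD ler_nat addnC -leq_subLR.
  rewrite -(ltn_pmul2r (isT : 0 < s)%N) -(ltr_nat R) natrM.
  apply: le_lt_trans m0 _; apply: le_lt_trans (_ : (D - 2 * w)%:R < _); last by rewrite ltr_nat.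
  by apply: le_trans DR; lra.
exists (H + w + m * s)%N.
  by apply/mapP; exists m; rewrite ?mem_iota// Fi.
rewrite !natrD natrM; rewrite -natr1 in m1; apply/andP; split; lra.
Qed.

End Faces.

Section FaceBoxes.
Variables (R : realType) (n D H : nat) (W g : seq bool -> nat -> nat).

Definition face_boxes : seq ('rV[R]_n * 'rV[R]_n) :=
  [seq (\row_(i < n) (((nth 0%N p.2 i)%:R - H%:R) / D%:R),
        \row_(i < n) ((side D H W g p.1 i)%:R / D%:R))
  | p <- [seq (F, c) | F <- low_faces n, c <- prodseq [seq corners D H W g F i | i <- iota 0 n]]].

Lemma size_face_boxes : size face_boxes = sumn [seq face_count n g F | F <- low_faces n].
Proof.
rewrite size_map size_allpairs_dep; congr sumn; apply: eq_map => F.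
rewrite size_prodseq -map_comp /face_count; congr foldr; apply: eq_map => i /=.
by rewrite /corners; case: ifP => // _; rewrite size_map size_iota.
Qed.

Hypotheses (D0 : (0 < D)%N) (faces_ok : all (face_ok n D H W g) (low_faces n)).

(** Two coordinates near the boundary determine the (n-2)-face [F0] from which to descend; at the
    final face a corner is chosen coordinatewise. *)
Lemma face_boxes_cover : skeleton_cover (H%:R / D%:R) face_boxes.
Proof.
have DR0 : 0 < D%:R :> R by rewrite ltr0n.
split=> [_ /mapP[_ /allpairsPdep[F [c [Fl _ ->]]] ->]|x x01 [i [j [ij xi xj]]]] /=.
  split=> [i|]; first by rewrite mxE divr_ge0.
  rewrite (eq_bigr (fun i : 'I_n => (side D H W g F i)%:R / D%:R)); last first.
    by move=> i _; rewrite mxE.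
  rewrite -mulr_suml ltr_pdivrMr// mul1r -natr_sum ltr_nat.
  by have /and4P[] := allP faces_ok _ Fl; rewrite sumn_side.
pose X (k : nat) : R := oapp (fun i : 'I_n => D%:R * x i) 0 (insub k).
have XE (k : 'I_n) : X k = D%:R * x k by rewrite /X valK.
pose F0 := clear_bit (clear_bit (nseq n true) i) j.
have sF0 : size F0 = n by rewrite !size_set_nth size_nseq !(maxn_idPr _).
have nF0 (k : nat) : (k < n)%N -> nth false F0 k = (k != i) && (k != j).
  by move=> kn; rewrite !nth_clear_bit nth_nseq kn andTb.
have cF0 : count id F0 = (n - 2)%N.
  rewrite /F0 /clear_bit count_set_nth_ltn; last by rewrite size_set_nth size_nseq (maxn_idPr _).
  rewrite count_set_nth_ltn ?size_nseq// count_nseq mul1n nth_nseq ltn_ord.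
  rewrite -/(clear_bit _ _) nth_clear_bit nth_nseq ltn_ord andTb eq_sym ij.
  by rewrite !addn0 -subnDA.
have [_ _ HW _] := face_okP faces_ok sF0 (eq_leq cF0).
have bd (k : 'I_n) : near01 (H%:R / D%:R) (x k) -> (H <= W F0 k)%N -> near_bd D W X F0 k.
  move=> xk HWk; rewrite /near_bd XE; have HWR : H%:R <= (W F0 k)%:R :> R by rewrite ler_nat.
  apply/orP; case: xk => xk; [left|right].
    by apply: le_trans HWR; rewrite mulrC -ler_pdivlMr.
  apply: le_trans (_ : D%:R - H%:R <= _); first by rewrite lerD2l lerN2.
  by rewrite -(ler_pM2l DR0) mulrBr mulr1 mulrC divfK ?gt_eqF// in xk.
have near0 (k : nat) : (k < n)%N -> ~~ nth false F0 k -> near_bd D W X F0 k.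
  move=> kn; move=> /[dup] /(HW cF0 k kn) HWk; rewrite nF0// negb_and !negbK.
  by move=> /orP[/eqP kE|/eqP kE]; move: HWk; rewrite kE; apply: bd.
have [F [sF cF Fnear Faway]] := descend faces_ok sF0 (eq_leq cF0) near0.
have Xbd (k : nat) : (k < n)%N -> - H%:R <= X k <= D%:R + H%:R.
  move=> kn; have := x01 (Ordinal kn); rewrite -[k]/(val (Ordinal kn)) XE.
  rewrite -(ler_pM2l DR0) -[X in _ && X](ler_pM2l DR0).
  by rewrite mulrN mulrDr mulr1 mulrC divfK ?gt_eqF.
have [|q Hq] := @choice nat nat (fun k q => (k < n)%N -> q \in corners D H W g F k /\
    q%:R - H%:R <= X k <= q%:R - H%:R + (side D H W g F k)%:R).
  move=> k; case: (ltnP k n) => kn; last by exists 0%N.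
  have [q qc qX] := corner_cover faces_ok sF cF kn (Fnear k kn) (Faway k kn) (Xbd k kn).
  by exists q.
pose c := mkseq q n.
exists (\row_(i < n) (((nth 0%N c i)%:R - H%:R) / D%:R),
        \row_(i < n) ((side D H W g F i)%:R / D%:R)).
  apply/mapP; exists (F, c) => //; apply/allpairsPdep; exists F, c; split => //.
    exact: low_facesP.
  apply: (mem_prodseq (x0 := 0%N)) => [|k]; rewrite size_map ?size_iota ?size_mkseq// => kn.
  by rewrite nth_mkseq// (nth_map 0%N) ?size_iota// nth_iota// add0n; exact: (Hq k kn).1.
move=> k; rewrite /= !mxE nth_mkseq//; have := (Hq k (ltn_ord k)).2; rewrite XE.
by rewrite -mulrDl ler_pdivrMr// ler_pdivlMr// ![x k * _]mulrC.
Qed.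
End FaceBoxes.

(** * Bounds on the Hadwiger numbers *)

Lemma convex_body_covered (R : realType) (n D H : nat) (W g : seq bool -> nat -> nat)
    (K : set 'rV[R]_n) :
  (1 < n)%N -> (0 < H < D)%N -> all (face_ok n D H W g) (low_faces n) -> convex_body K ->
  covered_by_at_most K K° (sumn [seq face_count n g F | F <- low_faces n] + n).
Proof.
move=> n1 /andP[H0 HD] faces_ok [cK coK K0].
have D0 : (0 < D)%N by exact: leq_trans HD.
rewrite -(size_face_boxes R n D H W g).
have [V [uV wV Vmax Vnorm]] := extremal_frame coK K0.
have K1 : K !=set0 by case: K0 => c Kc; exists c; exact: interior_subset.
have [|a aP] := @choice 'I_n 'rV[R]_n (fun i a => K a /\ K (a + row i (invmx V))).
  move=> i.
  by have [a Ka Kae] := frame_chord cK coK wV K1 (Vmax i); exists a.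
have [c Kc] := K0.
have eta01 : 0 < (H%:R / D%:R : R) < 1.
  by rewrite divr_gt0 ?ltr0n//= ltr_pdivrMr ?ltr0n// mul1r ltr_nat.
apply: (frame_covered (a := a) cK uV wV Kc n1 eta01 (face_boxes_cover R D0 faces_ok)) => //.
- by move=> i; exact: (aP i).1.
- by move=> i; exact: (aP i).2.
move=> i j ij; apply: frame_not_sharp => //; [by case/andP: eta01|exact: Vnorm].
Qed.

Lemma is_Hadwiger_number_exists (R : realType) (n N : nat) : (0 < N)%N ->
  (forall K : set 'rV[R]_n, convex_body K -> covered_by_at_most K K° N) ->
  exists2 M : nat, is_Hadwiger_number R n M & (M <= N)%N.
Proof.
move=> N0 HN; have exP : exists M, `[< Hadwiger_bound R n M >] by exists N; apply/asboolP.
case: (ex_minnP exP) => M /asboolP HM minM; exists M.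
  by split => // M' /asboolP; exact: minM.
by apply: minM; apply/asboolP.
Qed.

Lemma covered_by_at_mostW (R : realType) (n : nat) (A B : set 'rV[R]_n) (M N : nat) :
  (M <= N)%N -> covered_by_at_most A B M -> covered_by_at_most A B N.
Proof. by move=> MN [s sM cov]; exists s => //; exact: leq_trans MN. Qed.

(* In depth4 and grid4, the sum of the free directions identifies the free
   direction of an edge and the partner of i in a two-dimensional face.  In
   dimension 5 the boxes of the face spanned by i and j hardly reach in the
   direction k with 2 k = i + j mod 5, so the faces spanned by i, j and k need
   three pieces there instead of two. *)
Section Data.
Local Open Scope nat_scope.
Implicit Types (F : seq bool) (i j : nat).

Definition dirsum F := sumn (mask F (iota 0 (size F))).

Definition depth4 F j :=
  nth 0 (nth [::] [:: [:: 1298; 1298; 1195; 1195];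
    nth [::] [:: [:: 0; 1255; 1195; 2]; [:: 1255; 0; 2; 1195];
                 [:: 120; 1255; 0; 950]; [:: 1255; 120; 610; 0]] (dirsum F);
    [:: 1; 1; 1; 1]] (count id F)) j.

Definition grid4 F i :=
  if count id F == 1 then 1 else
  nth 0 (nth [::] [:: [:: 0; 1; 2; 1]; [:: 1; 0; 1; 2]; [:: 1; 2; 0; 2]; [:: 2; 1; 1; 0]] i)
    (dirsum F - i).

Definition depth5 F j :=
  if (count id F == 2) && (2 * j == dirsum F %[mod 5]) then 1
  else nth 0 [:: 298; 260; 255; 1] (count id F).

Definition grid5 F i :=
  if (count id F == 3) && (3 * i == dirsum F %[mod 5]) then 3 else 2.

Definition depth6 F j := nth 0 [:: 415; 331; 278; 183; 1] (count id F).

(** Pieces are allotted by the rank of i among the free directions. Uneven splittings can save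
    boxes: on a 2-face, 2 and 4 pieces make 8 boxes, against 9 for 3 and 3. *)
Definition grid6 F i :=
  nth 0 (nth [::] [:: [::]; [:: 2]; [:: 2; 4]; [:: 3; 3; 3]; [:: 3; 3; 4; 4]] (count id F))
    (count id (take i F)).
End Data.

Theorem theorem1p3 (R : realType) :
  [/\ exists2 N : nat, is_Hadwiger_number R 4 N & (N <= 96)%N,
      exists2 N : nat, is_Hadwiger_number R 5 N & (N <= 1091)%N &
      exists2 N : nat, is_Hadwiger_number R 6 N & (N <= 15373)%N].
Proof.
split; apply: is_Hadwiger_number_exists => [|K bK]; try exact: ltn0Sn.
(* Here eta = 1 / 5000, and the count is 92 + 4. *)
- have ok : all (face_ok 4 5000 1 depth4 grid4) (low_faces 4) by vm_compute.
  apply: covered_by_at_mostW (convex_body_covered _ _ ok bK); by vm_compute.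
- have ok : all (face_ok 5 1500 1 depth5 grid5) (low_faces 5) by vm_compute.
  apply: covered_by_at_mostW (convex_body_covered _ _ ok bK); by vm_compute.
- have ok : all (face_ok 6 2500 1 depth6 grid6) (low_faces 6) by vm_compute.
  apply: covered_by_at_mostW (convex_body_covered _ _ ok bK); by vm_compute.
Qed.
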